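(* Let $w=(w(n))_{n\in\mathbb{N}}$ be a bounded, strictly positive sequence such that $\mathsf{C}$ maps $\ell_1(w)$ into itself and $\mathsf{C}^{(1,w)}\colon\ell_1(w)\to\ell_1(w)$ is compact. Then necessarily $$\mathcal{U}_w:=\sup_{m\in\mathbb{N}}\frac{1}{m\,w(m+1)}\sum_{n=m+1}^\infty w(n)<\infty.$$ In particular, $\mathsf{C}^{(1,w)}$ is both power bounded and uniformly mean ergodic.
   Context: The discrete Cesàro operator $\mathsf{C}\colon\mathbb{C}^{\mathbb{N}}\to\mathbb{C}^{\mathbb{N}}$ is the linear map $\mathsf{C}x:=\left(\frac{x_1+\dots+x_n}{n}\right)_{n\in\mathbb{N}}$ for $x=(x_n)_{n\in\mathbb{N}}$, with $\mathbb{N}=\{1,2,\dots\}$. For a bounded, strictly positive sequence $w$, $\ell_1(w):=\{x\in\mathbb{C}^{\mathbb{N}}\colon \sum_{n=1}^\infty w(n)|x_n|<\infty\}$, a Banach space for the norm $\|x\|_{1,w}:=\sum_{n=1}^\infty w(n)|x_n|$. $\mathsf{C}^{(1,w)}$ denotes the restriction of $\mathsf{C}$ to $\ell_1(w)$. $\mathcal{L}(X)$ is the space of continuous linear operators on a Banach space $X$. For $T\in\mathcal{L}(X)$ let $T_{[n]}:=\frac1n\sum_{m=1}^nT^m$, $n\in\mathbb{N}$. $T$ is power bounded if $\sup_n\|T^n\|<\infty$; uniformly mean ergodic if $\{T_{[n]}\}_{n\in\mathbb{N}}$ converges in the operator norm to some $P\in\mathcal{L}(X)$. *)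

(* Defs.v *)
From HB Require Import structures.
From mathcomp Require Import all_boot all_order all_algebra.
From mathcomp Require Import complex.
From mathcomp Require Import all_classical all_reals all_analysis.

Set Implicit Arguments.
Unset Strict Implicit.
Unset Printing Implicit Defensive.
Import Order.TTheory GRing.Theory Num.Theory.
Import numFieldNormedType.Exports.
Local Open Scope classical_set_scope.
Local Open Scope ring_scope.
Local Open Scope complex_scope.

(* Sequences (x_1, x_2, ...) are functions on nat, with x_(n+1) the value at n.
   Complex normed spaces have norms in R[i] (real elements); rnorm is the same
   norm with values in R. *)

Section Operators.
Context {R : realType}.

Definition rnorm {V : normedModType R[i]} (v : V) : R := complex.Re `|v|.

(* valued in \bar R: it is +oo when T is unbounded *)
Definition opnorm {V W : normedModType R[i]} (T : V -> W) : \bar R :=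
  ereal_sup [set (rnorm (T x))%:E | x in [set x : V | `|x| <= 1]].

Definition compact_operator {V W : normedModType R[i]}
    (T : {linear V -> W}) : Prop :=
  precompact (T @` [set x : V | `|x| <= 1]).

Definition power_bounded {V : normedModType R[i]} (T : {linear V -> V}) : Prop :=
  continuous T /\
  (ereal_sup [set opnorm (iter n T) | n in [set n | (0 < n)%N]] < +oo)%E.

Definition ergodic_mean {V : normedModType R[i]} (T : V -> V) (n : nat) (x : V)
    : V :=
  n%:R^-1 *: \sum_(1 <= m < n.+1) iter m T x.

Definition uniformly_mean_ergodic {V : normedModType R[i]}
    (T : {linear V -> V}) : Prop :=
  continuous T /\
  exists P : {linear V -> V}, continuous P /\
    opnorm (fun x => ergodic_mean T n x - P x) @[n --> \oo] --> 0%E.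

End Operators.

Section Ell1.
Context {R : realType}.
Implicit Types (w : nat -> {posnum R}) (x y : nat -> R[i]).

Local Notation normc := ComplexField.Normc.normc.

Definition wsum w x : \bar R := (\sum_(n <oo) ((w n)%:num * normc (x n))%:E)%E.

Definition in_ell1 w : {pred nat -> R[i]} := mem [set x | (wsum w x < +oo)%E].

Lemma in_ell1E w x : (x \in in_ell1 w) = (wsum w x < +oo)%E.
Proof. by apply/idP/idP; rewrite inE. Qed.

Lemma normc_ge0 (z : R[i]) : 0 <= normc z.
Proof. by case: z => a b; exact: sqrtr_ge0. Qed.

Lemma wterm_ge0 w x n : (0 <= ((w n)%:num * normc (x n))%:E)%E.
Proof. by rewrite lee_fin mulr_ge0// normc_ge0. Qed.

Lemma wsum_ge0 w x : (0 <= wsum w x)%E.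
Proof. by apply: nneseries_ge0 => n _ _; exact: wterm_ge0. Qed.

Lemma wsumD w x y : (wsum w (x + y)%R <= wsum w x + wsum w y)%E.
Proof.
rewrite /wsum -nneseriesD; [|by move=> *; exact: wterm_ge0..].
apply: lee_nneseries => n _ => [_|]; first exact: wterm_ge0.
rewrite -EFinD lee_fin -mulrDr ler_wpM2l//.
exact: (@le_normcD R (x n) (y n)).
Qed.

Lemma wsumZ w (a : R[i]) x : wsum w (a *: x) = ((normc a)%:E * wsum w x)%E.
Proof.
rewrite /wsum -nneseriesZl; last by move=> *; exact: wterm_ge0.
apply: eq_eseriesr => n _; rewrite -EFinM; congr (_%:E).
by rewrite mulrCA -ComplexField.Normc.normcM.
Qed.

Lemma wsum0 w : wsum w 0 = 0%E.
Proof. by rewrite -(scale0r 0) wsumZ ComplexField.Normc.normc0 mul0e. Qed.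

Lemma wsum_eq0 w x : wsum w x = 0%E -> x = 0.
Proof.
move=> x0; apply/funext => n; apply: ComplexField.Normc.eq0_normc.
have : (((w n)%:num * normc (x n))%:E <= 0)%E.
  rewrite -x0 /wsum (nneseriesD1 (n := n))//; last first.
    by move=> k _; exact: wterm_ge0.
  by rewrite leeDl// nneseries_ge0// => k _ _; exact: wterm_ge0.
rewrite lee_fin pmulr_rle0// => le0.
by apply/eqP; rewrite eq_le le0 normc_ge0.
Qed.

Fact in_ell1_submod w : submod_closed (in_ell1 w).
Proof.
split=> [|a x y]; rewrite !in_ell1E; first by rewrite wsum0.
move=> xw yw; apply: le_lt_trans (wsumD _ _ _) _.
by rewrite wsumZ lte_add_pinfty// lte_mul_pinfty// lee_fin normc_ge0.
Qed.

HB.instance Definition _ w :=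
  GRing.isSubmodClosed.Build _ _ (in_ell1 w) (in_ell1_submod w).

Record ell1 w := Ell1 { ell1_val :> nat -> R[i]; ell1P : ell1_val \in in_ell1 w }.

HB.instance Definition _ w := [isSub for @ell1_val w].
HB.instance Definition _ w := [Choice of ell1 w by <:].
HB.instance Definition _ w := [SubChoice_isSubLmodule of ell1 w by <:].

Definition ell1_norm w (x : ell1 w) : R[i] := (fine (wsum w x))%:C.

Lemma ell1_wsumK w (x : ell1 w) : (fine (wsum w x))%:E = wsum w x.
Proof.
rewrite fineK// ge0_fin_numE; last exact: wsum_ge0.
by have := ell1P x; rewrite in_ell1E.
Qed.

Fact ell1_normD w (x y : ell1 w) :
  ell1_norm (x + y) <= ell1_norm x + ell1_norm y.
Proof.
rewrite /ell1_norm -rmorphD lecR -lee_fin EFinD !ell1_wsumK.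
exact: wsumD.
Qed.

Fact ell1_normZ w (a : R[i]) (x : ell1 w) :
  ell1_norm (a *: x) = `|a| * ell1_norm x.
Proof.
rewrite /ell1_norm -[`|a|]/((normc a)%:C) -rmorphM; congr (_%:C).
by apply: EFin_inj; rewrite EFinM !ell1_wsumK -wsumZ.
Qed.

Fact ell1_norm0 w (x : ell1 w) : ell1_norm x = 0 -> x = 0.
Proof.
move=> [x0]; apply/val_inj/(@wsum_eq0 w).
by rewrite -ell1_wsumK x0.
Qed.

HB.instance Definition _ w := Lmodule_isNormed.Build R[i] (ell1 w)
  (@ell1_normD w) (@ell1_normZ w) (@ell1_norm0 w).

Lemma ell1_normE w (x : ell1 w) : `|x| = (fine (wsum w x))%:C.
Proof. by []. Qed.

Definition cesaro_op x : nat -> R[i] :=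
  fun n => (\sum_(i < n.+1) x i) / n.+1%:R.

Section Restriction.
Context {w : nat -> {posnum R}}
  (hC : forall x, x \in in_ell1 w -> cesaro_op x \in in_ell1 w).

Definition cesaro_ell1 (x : ell1 w) : ell1 w := Ell1 (hC (ell1P x)).

Fact cesaro_ell1_linear : linear cesaro_ell1.
Proof.
move=> a x y; apply/val_inj/funext => n /=.
by rewrite /cesaro_op big_split/= -scaler_sumr mulrDl -scalerAl.
Qed.

HB.instance Definition _ := GRing.isLinear.Build R[i] (ell1 w) (ell1 w) _
  cesaro_ell1 cesaro_ell1_linear.

End Restriction.

(* Here m is not shifted: it is the m >= 1 of the formula
   sup_m (m w(m+1))^-1 \sum_(n >= m+1) w(n), so w m stands for w(m+1). *)
Definition calU w : \bar R :=
  ereal_sup [set (((m%:R * (w m)%:num)^-1)%:E * \sum_(m <= n <oo) ((w n)%:num)%:E)%E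
            | m in [set m | (0 < m)%N]].

End Ell1.

(* Main.v *)
(** Compactness forces the columns [C (e_k / w k)], which tend to [0]
    coordinatewise, to tend to [0] in norm, so that
    [\sum_(n >= k) w n / n.+1 <= w k / 2] for large [k]. Abel summation turns this
    into [\sum_(n >= k) w n <= k * w k], whence [calU w] is finite and the constant
    sequences lie in [ell1 w]. Changing [w] at finitely many places gives an
    equivalent norm in which [C] contracts the invariant hyperplane [x 0 = 0] by the
    factor 3/4. Since [C] fixes constants, [C^m] converges geometrically in operator
    norm to the projection sending [x] to the constant sequence [x 0]. *)
Require Import Defs.
From HB Require Import structures.
From mathcomp Require Import all_boot all_order all_algebra.
From mathcomp Require Import complex.
From mathcomp Require Import all_classical all_reals all_analysis.
From mathcomp Require Import ring lra.
Import Order.TTheory GRing.Theory Num.Theory.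
Import numFieldNormedType.Exports.
Local Open Scope classical_set_scope.
Local Open Scope ring_scope.

Local Notation normc := ComplexField.Normc.normc.

(** * Tail bounds, Abel summation and change of weight *)

(** For a positive weight [u], the sums over [N] increase to the [u]-norm of [C e_k], so this says
    that [C] scales the norm of [e_k] by at most [r] for every [k >= K]. *)
Definition tail_le {R : realType} (u : nat -> R) (K : nat) (r : R) : Prop :=
  forall k N, (K <= k)%N -> \sum_(k <= n < N) u n / n.+1%:R <= r * u k.

(** Write [u j] as [j.+1] copies of [u j / j.+1]: the first summand counts [k] of them, and the
    double sum one for each [n] with [k <= n <= j]. *)
Lemma abel_sum {R : realType} (u : nat -> R) (k N : nat) :
  \sum_(k <= n < N) u n = k%:R * (\sum_(k <= j < N) u j / j.+1%:R) +
    \sum_(k <= n < N) \sum_(n <= j < N) u j / j.+1%:R.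
Proof.
have [kN|Nk] := leqP k N; last first.
  by rewrite !big_geq ?mulr0 ?addr0// ltnW.
rewrite -(subnK kN); move: (N - k)%N => d {kN}; elim: d k => [|d IHd] k.
  by rewrite add0n !big_geq// mulr0 addr0.
have kd : (k < d.+1 + k)%N by rewrite addSn ltnS leq_addl.
rewrite !(big_ltn kd) addSnnS IHd.
have uk : u k = k.+1%:R * (u k / k.+1%:R) by rewrite mulrC divfK// pnatr_eq0.
rewrite {1}uk; move: (u k / k.+1%:R) => a; rewrite -(natr1 k).
set b := \sum_(_ <= _ < _) _ / _; set e := \sum_(_ <= _ < _) \sum_(_ <= _ < _) _.
ring.
Qed.

(** In the Abel identity the double sum is at most half of the left side, which is a finite sum, so
    it can be absorbed there; the resulting bound is uniform in [N]. *)
Lemma tail_le_sum {R : realType} (u : nat -> R) (K k N : nat) :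
  tail_le u K 2^-1 -> (K <= k)%N -> \sum_(k <= n < N) u n <= k%:R * u k.
Proof.
move=> uK Kk; have := abel_sum u k N.
set S := \sum_(k <= n < N) u n.
have le1 : k%:R * \sum_(k <= j < N) u j / j.+1%:R <= k%:R * (2^-1 * u k).
  by rewrite ler_wpM2l// uK.
have : \sum_(k <= n < N) \sum_(n <= j < N) u j / j.+1%:R <= 2^-1 * S.
  rewrite mulr_sumr !big_nat; apply: ler_sum => n /andP[kn _].
  exact/uK/(leq_trans Kk).
lra.
Qed.

(* Raising the weight at [K] to [u K + 3 u (K + 1)] extends the tail bound from
   [K + 1] to [K], because [1 / (K + 1) + 1 / 4 <= 3 / 4] when [1 <= K]. *)
Lemma tail_le_renorm {R : realType} (u : nat -> R) (K : nat) :
  (forall n, 0 < u n) -> tail_le u K (3 / 4) ->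
  exists v c, (forall n, u n <= v n <= c * u n) /\ tail_le v 1 (3 / 4).
Proof.
elim: K u => [|K IHK] u u0 uK.
  exists u, 1; split=> [n|k N _]; last exact: uK.
  by rewrite mul1r lexx.
have [K0|K0] := posnP K.
  rewrite K0 in uK; exists u, 1; split=> [n|//].
  by rewrite mul1r lexx.
pose u' n := if n == K then u n + 3 * u n.+1 else u n.
have uu' n : u n <= u' n.
  by rewrite /u'; case: eqP => // _; rewrite lerDl mulr_ge0// ltW.
have eq_tail k N : (K < k)%N ->
    \sum_(k <= n < N) u' n / n.+1%:R = \sum_(k <= n < N) u n / n.+1%:R.
  move=> Kk; apply: eq_big_nat => n /andP[kn _].
  by rewrite /u' gtn_eqF// (leq_trans Kk).
have u'0 n : 0 < u' n by exact: lt_le_trans (uu' n).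
have [|v [c [vc v1]]] := IHK u' u'0.
  move=> k N; rewrite leq_eqVlt => /predU1P[<-|Kk]; last first.
    by rewrite eq_tail// /u' gtn_eqF//; exact: uK.
  have [KN|NK] := ltnP K N; last first.
    by rewrite big_geq// mulr_ge0// ltW.
  rewrite big_ltn// eq_tail//.
  have := uK _ N (leqnn K.+1).
  have : u' K / K.+1%:R <= u' K / 2.
    by rewrite ler_wpM2l ?(ltW (u'0 _))// lef_pV2 ?posrE// ler_nat ltnS.
  have := u0 K; move: (u' K / K.+1%:R) (\sum_(_ <= _ < _) _) => a b.
  by rewrite /u' eqxx; lra.
have c0 : 0 <= c.
  have /andP[a b] := vc 0%N.
  by rewrite -(pmulr_lge0 _ (u'0 0%N)) (le_trans _ b)// (le_trans _ a)// ltW.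
(* [c] compares [v] with [u']; the second factor is [u' K / u K], the only ratio of [u'] to [u]
   other than 1. *)
exists v, (c * (1 + 3 * u K.+1 / u K)); split=> // n.
have /andP[a b] := vc n.
rewrite (le_trans (uu' n) a)/= (le_trans b)// -(mulrA c) ler_wpM2l//.
rewrite /u'; case: eqP => [->|_].
  by rewrite [leRHS]mulrDl mul1r divfK// gt_eqF.
by rewrite ler_peMl ?(ltW (u0 _))// lerDl divr_ge0 ?mulr_ge0// ltW.
Qed.

(** * Contraction on the hyperplane [x 0 = 0] *)

Lemma normc_cesaro {R : realType} (x : nat -> R[i]) (n : nat) :
  normc (cesaro_op x n) <= (\sum_(i < n.+1) normc (x i)) / n.+1%:R.
Proof.
rewrite -lecR rmorphM rmorph_sum fmorphV rmorph_nat /=.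
rewrite -[(normc _)%:C%C]/(`|cesaro_op x n|) normrM normfV normr_nat.
by rewrite ler_wpM2r ?invr_ge0//; exact: ler_norm_sum.
Qed.

(** After exchanging the sums, [normc (x i)] carries a tail sum starting at [i], at most
    [3 / 4 * v i] for [i >= 1]. At [i = 0] that sum contains [v 0] itself, so no ratio below 1 is
    possible when [v 0 > 0]; hence [x 0 = 0]. *)
Lemma cesaro_contract {R : realType} (v : nat -> R) (x : nat -> R[i]) (N : nat) :
  (forall n, 0 <= v n) -> tail_le v 1 (3 / 4) -> x 0%N = 0 ->
  \sum_(0 <= n < N) v n * normc (cesaro_op x n)
    <= 3 / 4 * \sum_(0 <= n < N) v n * normc (x n).
Proof.
move=> v0 v1 x0.
apply: (@le_trans _ _ (\sum_(0 <= n < N) \sum_(0 <= i < N | (i <= n)%N)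
                         v n / n.+1%:R * normc (x i))).
  rewrite !big_nat; apply: ler_sum => n /andP[_ nN].
  rewrite -mulr_sumr -mulrA ler_wpM2l// (le_trans (normc_cesaro _ _))// mulrC.
  rewrite ler_wpM2l ?invr_ge0//.
  rewrite -(big_mkord xpredT (fun i => normc (x i))).
  by rewrite (big_nat_widen 0%N n.+1 N).
rewrite (exchange_big_dep_nat xpredT)//= mulr_sumr.
rewrite !big_nat; apply: ler_sum => i /andP[_ iN].
rewrite -mulr_suml mulrA.
have [->|i0] := posnP i.
  by rewrite x0 ComplexField.Normc.normc0 !mulr0.
rewrite ler_wpM2r ?normc_ge0//.
by have := v1 i N i0; rewrite (big_nat_widenl _ 0%N).
Qed.

Lemma iter_cesaro_contract {R : realType} (v : nat -> R) (x : nat -> R[i])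
    (m N : nat) :
  (forall n, 0 <= v n) -> tail_le v 1 (3 / 4) -> x 0%N = 0 ->
  \sum_(0 <= n < N) v n * normc (iter m cesaro_op x n)
    <= (3 / 4) ^+ m * \sum_(0 <= n < N) v n * normc (x n).
Proof.
move=> v0 v1 x0.
(* [C] preserves the first coordinate, so the hyperplane is invariant. *)
have it0 k : iter k cesaro_op x 0%N = 0.
  by elim: k => [//|k IHk]; rewrite iterS /cesaro_op big_ord1 IHk mul0r.
elim: m => [|m IHm]; first by rewrite expr0 mul1r.
rewrite iterS exprS -mulrA (le_trans (cesaro_contract _ _ _ _ _ _))//.
by rewrite ler_wpM2l.
Qed.

(** * The weighted norm through partial sums *)

Lemma rnorm_ell1 {R : realType} {w : nat -> {posnum R}} (x : ell1 w) :
  (rnorm x)%:E = wsum w x.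
Proof. by rewrite -ell1_wsumK. Qed.

Lemma norm_rnorm {R : realType} {V : normedModType R[i]} (x : V) :
  `|x| = (rnorm x)%:C%C.
Proof.
by have := ger0_Im (normr_ge0 x); rewrite /rnorm; case: `|x| => a b /= ->.
Qed.

Lemma ler_sum_rnorm {R : realType} {w : nat -> {posnum R}} (x : ell1 w) (N : nat) :
  \sum_(0 <= n < N) (w n)%:num * normc (x n) <= rnorm x.
Proof.
rewrite -lee_fin rnorm_ell1 -sumEFin.
by apply: nneseries_lim_ge => n _ _; exact: wterm_ge0.
Qed.

Lemma nneseries_fin_le {R : realType} (u : nat -> R) (m : nat) (B : R) :
  (forall n, 0 <= u n) -> (forall N, \sum_(m <= n < N) u n <= B) ->
  (\sum_(m <= n <oo) (u n)%:E <= B%:E)%E.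
Proof.
move=> u0 uB; apply: lime_le.
  by apply: is_cvg_nneseries => n _ _; rewrite lee_fin.
by apply: nearW => N; rewrite sumEFin lee_fin.
Qed.

Lemma rnorm_le {R : realType} {w : nat -> {posnum R}} (x : ell1 w) (B : R) :
  (forall N, \sum_(0 <= n < N) (w n)%:num * normc (x n) <= B) -> rnorm x <= B.
Proof.
move=> xB; rewrite -lee_fin rnorm_ell1; apply: nneseries_fin_le => // n.
by rewrite mulr_ge0// normc_ge0.
Qed.

Lemma coord_rnorm {R : realType} {w : nat -> {posnum R}} (x : ell1 w) (n : nat) :
  (w n)%:num * normc (x n) <= rnorm x.
Proof.
apply: le_trans (ler_sum_rnorm x n.+1); rewrite big_nat_recr//= lerDr.
by apply: sumr_ge0 => i _; rewrite mulr_ge0// normc_ge0.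
Qed.

Lemma normc_real {R : realType} (r : R) : 0 <= r -> normc r%:C%C = r.
Proof. by move=> r0; rewrite /= expr0n addr0 sqrtr_sqr ger0_norm. Qed.

Lemma mem_in_ell1 {R : realType} (w : nat -> {posnum R}) (x : nat -> R[i]) (B : R) :
  (forall N, \sum_(0 <= n < N) (w n)%:num * normc (x n) <= B) -> x \in in_ell1 w.
Proof.
move=> xB; rewrite in_ell1E; apply: (@le_lt_trans _ _ B%:E); last exact: ltry.
by apply: nneseries_fin_le => // n; rewrite mulr_ge0// normc_ge0.
Qed.

(** * Normalised unit vectors and compactness *)

Definition unit_seq {R : realType} (w : nat -> {posnum R}) (k : nat) : nat -> R[i] :=
  fun n => if n == k then ((w k)%:num^-1)%:C%C else 0.

Lemma sum_unit_seq {R : realType} (w : nat -> {posnum R}) (k N : nat) :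
  \sum_(0 <= n < N) (w n)%:num * normc (unit_seq w k n) <= 1.
Proof.
have -> : \sum_(0 <= n < N) (w n)%:num * normc (unit_seq w k n) =
          \sum_(0 <= n < N | n == k) 1.
  rewrite [RHS]big_mkcond; apply: eq_bigr => n _; rewrite /unit_seq.
  case: eqP => [->|_]; last by rewrite ComplexField.Normc.normc0 mulr0.
  by rewrite normc_real ?invr_ge0// divff.
by rewrite big_nat1_eq; case: ifP.
Qed.

Definition unit_ell1 {R : realType} (w : nat -> {posnum R}) (k : nat) : ell1 w :=
  Ell1 (mem_in_ell1 _ _ _ (sum_unit_seq w k)).

Lemma cesaro_unit_seq {R : realType} (w : nat -> {posnum R}) (k n : nat) :
  cesaro_op (unit_seq w k) n =
  if (k <= n)%N then ((w k)%:num^-1 / n.+1%:R)%:C%C else 0.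
Proof.
rewrite /cesaro_op.
have -> : \sum_(i < n.+1) unit_seq w k i =
    \sum_(i < n.+1 | i == k :> nat) ((w k)%:num^-1)%:C%C.
  by rewrite [RHS]big_mkcond.
rewrite (big_ord1_eq _ (fun=> _)) ltnS; case: ifP => _.
  by rewrite rmorphM; congr (_ * _); rewrite fmorphV rmorph_nat.
by rewrite mul0r.
Qed.

(* The images [C (e_k / w k)] of the normalised unit vectors tend to [0]
   coordinatewise, so [0] is their only possible cluster point. *)
Lemma compact_tail_le {R : realType} (w : nat -> {posnum R})
    (hC : forall x : nat -> R[i], x \in in_ell1 w -> cesaro_op x \in in_ell1 w) :
  compact_operator (cesaro_ell1 hC) ->
  exists K, tail_le (fun n => (w n)%:num) K 2^-1.
Proof.
rewrite /compact_operator precompactE => cpt; apply: contrapT => noK.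
have bad K : exists k, (K <= k)%N /\
    exists N, 2^-1 * (w k)%:num < \sum_(k <= n < N) (w n)%:num / n.+1%:R.
  apply: contrapT => noKk; apply: noK; exists K => k N Kk.
  by rewrite leNgt; apply/negP => lt; apply: noKk; exists k; split=> //; exists N.
have [f fP] := choice bad.
pose y n := cesaro_ell1 hC (unit_ell1 w (f n)).
(* The norm of [C (e_k / w k)] is the tail sum divided by [w k], so failure of the bound at
   [k = f n] puts it above 1/2. *)
have y_big n : 2^-1 < rnorm (y n).
  have [_ [N ltN]] := fP n.
  apply: lt_le_trans (ler_sum_rnorm _ N).
  apply: (@lt_le_trans _ _
      (\sum_(f n <= j < N) (w j)%:num * ((w (f n))%:num^-1 / j.+1%:R))).
    rewrite -(ltr_pM2r (gt0 (w (f n)))) (lt_le_trans ltN)// mulr_suml.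
    apply: ler_sum => j _; rewrite -mulrA (mulrAC _ _ (w (f n))%:num) mulVf//.
    by rewrite mul1r.
  rewrite (big_nat_widenl _ 0%N)// [leLHS]big_mkcond; apply: ler_sum => j _ /=.
  rewrite cesaro_unit_seq; case: ifP => _; last by rewrite mulr_ge0// normc_ge0.
  by rewrite normc_real// divr_ge0.
have [z [_ zcl]] : closure (cesaro_ell1 hC @` [set x | `|x| <= 1]) `&`
    cluster (y @ \oo) !=set0.
  apply: cpt; exists 0%N => // n _; apply: subset_closure.
  exists (unit_ell1 w (f n)) => //=.
  by rewrite norm_rnorm (lecR _ 1); apply: rnorm_le; exact: sum_unit_seq.
have near_z (d : R) M : 0 < d -> exists n, (M <= n)%N /\ rnorm (z - y n) < d.
  move=> d0.
  have [] := zcl [set v | exists2 n, (M <= n)%N & v = y n] (ball z d%:C%C).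
  - by exists M => // n /= Mn; exists n.
  - by apply: nbhsx_ballx; rewrite ltcR.
  move=> v [[n Mn ->]]; rewrite -ball_normE /= norm_rnorm ltcR => zn.
  by exists n.
have z0 j : z j = 0.
  apply: ComplexField.Normc.eq0_normc; apply/eqP; rewrite eq_le normc_ge0 andbT.
  rewrite -(pmulr_rle0 _ (gt0 (w j))).
  apply/ler_addgt0Pr => d d0; rewrite add0r.
  (* For [n > j] also [f n > j], so coordinate [j] of [y n] vanishes and [w j * normc (z j)] is at
     most the norm of [z - y n]. *)
  have [n [jn zn]] := near_z d j.+1 d0.
  have <- : (z - y n) j = z j.
    change (z j - cesaro_op (unit_seq w (f n)) j = z j).
    by rewrite cesaro_unit_seq leqNgt (leq_trans jn (fP n).1)/= subr0.
  exact: le_trans (coord_rnorm _ j) (ltW zn).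
have {}z0 : z = 0 by apply/val_inj/funext.
have [|n [_]] := near_z 2^-1 0%N; first by rewrite invr_gt0.
by rewrite z0 sub0r /rnorm normrN => /(lt_trans (y_big n)); rewrite ltxx.
Qed.

(** * Operator norms and geometric convergence of powers *)

Section Rnorm.
Context {R : realType}.
Implicit Types V : normedModType R[i].

Lemma rnorm_ge0 {V} (x : V) : 0 <= rnorm x.
Proof. by rewrite -(lecR 0) -norm_rnorm; exact: normr_ge0. Qed.

Lemma rnormD {V} (x y : V) : rnorm (x + y) <= rnorm x + rnorm y.
Proof. by have := ler_normD x y; rewrite !norm_rnorm -rmorphD lecR. Qed.

Lemma rnormB {V} (x y : V) : rnorm (x - y) <= rnorm x + rnorm y.
Proof. by have := ler_normB x y; rewrite !norm_rnorm -rmorphD lecR. Qed.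

Lemma rnormZ {V} (a : R[i]) (x : V) : rnorm (a *: x) = normc a * rnorm x.
Proof.
have := normrZ a x; rewrite !norm_rnorm -[`|a|]/((normc a)%:C%C) -rmorphM.
exact: complexI.
Qed.

Lemma rnorm_sum {V} (I : Type) (r : seq I) (F : I -> V) :
  rnorm (\sum_(i <- r) F i) <= \sum_(i <- r) rnorm (F i).
Proof.
have := ler_norm_sum r F xpredT; rewrite norm_rnorm.
by rewrite (eq_bigr _ (fun i _ => norm_rnorm (F i))) -rmorph_sum lecR.
Qed.

Lemma bounded_rnorm_continuous {V} (f : {linear V -> V}) (D : R) :
  0 <= D -> (forall x, rnorm (f x) <= D * rnorm x) -> continuous f.
Proof.
move=> D0 fD; apply: bounded_linear_continuous.
exists D%:C%C; split; first by rewrite realE (lecR 0) D0.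
move=> M DM; have /= := @nbhsx_ballx _ V 0 1 ltr01.
apply: filterS => x; rewrite -ball_normE/= sub0r normrN norm_rnorm.
rewrite (ltcR _ 1) => x1; rewrite norm_rnorm (le_trans _ (ltW DM))// lecR.
by rewrite (le_trans (fD x))// ler_piMr// ltW.
Qed.

Lemma opnorm_le {V} (f : V -> V) (B : R) :
  0 <= B -> (forall x, rnorm (f x) <= B * rnorm x) -> (opnorm f <= B%:E)%E.
Proof.
move=> B0 fB; apply: ge_ereal_sup => _ [x /= x1 <-]; rewrite lee_fin.
rewrite (le_trans (fB x))// ler_piMr// -(lecR _ 1) -norm_rnorm.
exact: x1.
Qed.

Lemma opnorm_ge0 {V} (f : V -> V) : (0 <= opnorm f)%E.
Proof.
apply: (@le_trans _ _ (rnorm (f 0))%:E); first by rewrite lee_fin rnorm_ge0.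
by apply: ereal_sup_ubound; exists 0 => //=; rewrite normr0.
Qed.

Lemma sum_geometric_le (q : R) (n : nat) :
  0 <= q -> q < 1 -> \sum_(1 <= m < n.+1) q ^+ m <= (1 - q)^-1.
Proof.
move=> q0 q1.
have sumE : (1 - q) * \sum_(1 <= m < n.+1) q ^+ m = q - q ^+ n.+1.
  elim: n => [|n IHn]; first by rewrite big_geq// mulr0 expr1 subrr.
  by rewrite big_nat_recr//= mulrDr IHn (exprS q n.+1); ring.
rewrite -(ler_pM2l (_ : 0 < 1 - q)) ?subr_gt0// sumE divff ?subr_eq0 ?gt_eqF//.
have : 0 <= q ^+ n.+1 by exact: exprn_ge0.
lra.
Qed.

(** The mean minus [P] is the average of the [T^m - P], whose norms have sum at most [E / (1 - q)]
    for every [n]; dividing by [n] gives the limit 0. *)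
Lemma geometric_power_cvg {V} (T P : {linear V -> V}) (q E D : R) :
  0 <= q -> q < 1 -> 0 <= E -> 0 <= D ->
  (forall m x, rnorm (iter m T x - P x) <= E * q ^+ m * rnorm x) ->
  (forall x, rnorm (P x) <= D * rnorm x) ->
  power_bounded T /\ uniformly_mean_ergodic T.
Proof.
move=> q0 q1 E0 D0 TP PD.
have Tm m x : rnorm (iter m T x) <= (E + D) * rnorm x.
  rewrite -(subrK (P x) (iter m T x)) (le_trans (rnormD _ _))// mulrDl lerD//.
  rewrite (le_trans (TP m x))// ler_wpM2r ?rnorm_ge0// ler_piMr//.
  by rewrite exprn_ile1// ltW.
have ED0 : 0 <= E + D by rewrite addr_ge0.
have Tcont : continuous T by exact: (bounded_rnorm_continuous _ _ ED0 (Tm 1%N)).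
split; split=> //.
  apply: (@le_lt_trans _ _ (E + D)%:E); last exact: ltry.
  by apply: ge_ereal_sup => _ [m _ <-]; apply: opnorm_le => // x; exact: Tm.
exists P; split; first exact: (bounded_rnorm_continuous _ _ D0 PD).
pose B := E * (1 - q)^-1.
have B0 : 0 <= B by rewrite mulr_ge0// invr_ge0 subr_ge0 ltW.
(* The shift drops [n = 0] and matches [harmonic n], which is [1 / (n + 1)]. *)
pose g n := opnorm (fun x : V => ergodic_mean T n.+1 x - P x).
rewrite -cvg_shiftS.
apply: (@squeeze_cvge _ _ _ _ (cst 0%E) g (fun n => (B * harmonic n)%:E) _ 0%E).
- apply: nearW => n; rewrite opnorm_ge0/=; apply: opnorm_le.
    by rewrite mulr_ge0// invr_ge0.
  move=> x.
  have -> : ergodic_mean T n.+1 x - P x =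
      n.+1%:R^-1 *: \sum_(1 <= m < n.+2) (iter m T x - P x).
    rewrite /ergodic_mean sumrB scalerBr sumr_const_nat; congr (_ - _).
    by rewrite subn1/= -(scaler_nat _ (P x)) scalerA mulVf ?pnatr_eq0// scale1r.
  rewrite rnormZ ComplexField.Normc.normcV.
  have -> : normc (n.+1%:R : R[i]) = n.+1%:R.
    by rewrite -(rmorph_nat (real_complex R)) normc_real.
  rewrite mulrC -mulrA (mulrC _ (rnorm x)) mulrA ler_wpM2r ?invr_ge0//.
  rewrite (le_trans (rnorm_sum _ _ _))//.
  apply: (@le_trans _ _ (\sum_(1 <= m < n.+2) E * q ^+ m * rnorm x)).
    by apply: ler_sum => m _; exact: TP.
  rewrite -mulr_suml -mulr_sumr ler_wpM2r ?rnorm_ge0// ler_wpM2l//.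
  exact: sum_geometric_le.
- exact: cvg_cst.
- apply: cvg_EFin; first exact: nearW.
  rewrite -[X in _ --> X](mulr0 B); apply: cvgM; first exact: cvg_cst.
  exact: cvg_harmonic.
Qed.

End Rnorm.

(** * Finiteness of [calU] and the limit projection *)

Lemma calU_lt_pinfty {R : realType} (w : nat -> {posnum R}) (K : nat) (T : R) :
  (forall N, \sum_(0 <= n < N) (w n)%:num <= T) ->
  tail_le (fun n => (w n)%:num) K 2^-1 -> (calU w < +oo)%E.
Proof.
move=> wT wK.
have T0 : 0 <= T by have := wT 0%N; rewrite big_geq.
have winv0 : 0 <= \sum_(i < K) (w i)%:num^-1.
  by apply: sumr_ge0 => i _; rewrite invr_ge0.
(* The 1 covers [m >= K], by [tail_le_sum]. The other summand covers the finitely many [m < K],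
   where the tail is at most the total mass bound [T] and [1 / w m] is one term of the sum. *)
pose B := 1 + (\sum_(i < K) (w i)%:num^-1) * T.
apply: (@le_lt_trans _ _ B%:E); last exact: ltry.
apply: ge_ereal_sup => _ [m /= m0 <-].
have mw0 : 0 < m%:R * (w m)%:num by rewrite mulr_gt0// ltr0n.
rewrite lee_pdivrMl//; apply: nneseries_fin_le => // N.
have [Km|mK] := leqP K m.
  apply: (le_trans (tail_le_sum _ _ _ N wK Km)).
  by rewrite ler_peMr ?(ltW mw0)// lerDl mulr_ge0.
apply: (@le_trans _ _ T).
  apply: le_trans (wT N); rewrite (big_nat_widenl _ 0%N)// [leLHS]big_mkcond.
  by apply: ler_sum => n _; case: ifP.
rewrite mulrDr mulr1 ler_wpDl ?(ltW mw0)// mulrA ler_peMl//.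
rewrite -mulrA -[leLHS]mul1r ler_pM ?ler1n//.
rewrite (bigD1 (Ordinal mK))//= mulrDr divff// lerDl mulr_ge0//.
by apply: sumr_ge0 => i _; rewrite invr_ge0.
Qed.

Section Projection.
Context {R : realType} {w : nat -> {posnum R}} (e : ell1 w).

Definition first_coord (x : ell1 w) : ell1 w := x 0%N *: e.

Fact first_coord_linear : linear first_coord.
Proof. by move=> a x y; rewrite /first_coord scalerA -scalerDl. Qed.

HB.instance Definition _ :=
  GRing.isLinear.Build R[i] (ell1 w) (ell1 w) _ first_coord first_coord_linear.

Lemma rnorm_first_coord (x : ell1 w) :
  rnorm (first_coord x) <= rnorm e / (w 0%N)%:num * rnorm x.
Proof.
rewrite /first_coord rnormZ mulrC -mulrA ler_wpM2l ?rnorm_ge0//.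
by rewrite ler_pdivlMl// coord_rnorm.
Qed.

End Projection.

Theorem proposition4p14 (R : realType) (w : nat -> {posnum R})
    (w_bounded : exists M : R, forall n, (w n)%:num <= M)
    (hC : forall x : nat -> R[i], x \in in_ell1 w -> cesaro_op x \in in_ell1 w)
    (C_compact : compact_operator (cesaro_ell1 hC)) :
  (calU w < +oo)%E /\
  power_bounded (cesaro_ell1 hC) /\ uniformly_mean_ergodic (cesaro_ell1 hC).
Proof.
have [K wK] := compact_tail_le _ _ C_compact.
(* The second summand is the bound of [tail_le_sum] on the mass from [K] on. *)
pose T := \sum_(0 <= n < K) (w n)%:num + K%:R * (w K)%:num.
have wT N : \sum_(0 <= n < N) (w n)%:num <= T.
  apply: (@le_trans _ _ (\sum_(0 <= n < K + N) (w n)%:num)).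
    rewrite (big_cat_nat _ (leq_addl K N))//= lerDl.
    exact: sumr_ge0.
  rewrite (big_cat_nat _ (leq_addr N K))//= lerD2l.
  exact: (tail_le_sum _ _ _ _ wK).
split; first exact: calU_lt_pinfty wK.
have oneT N : \sum_(0 <= n < N) (w n)%:num * normc (1 : R[i]) <= T.
  by under eq_bigr do rewrite ComplexField.Normc.normc1 mulr1.
pose e : ell1 w := Ell1 (mem_in_ell1 _ (fun=> 1) _ oneT).
have Ce : cesaro_ell1 hC e = e.
  apply/val_inj/funext => n /=; rewrite /cesaro_op sumr_const card_ord.
  by rewrite divff// pnatr_eq0.
(* The ratio 1/2 leaves no room for renormalising: at index 1 the leading term alone uses
   [1 / (1 + 1)]. *)
have wK' : tail_le (fun n => (w n)%:num) K (3 / 4).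
  move=> k N Kk; apply: le_trans (wK k N Kk) _.
  by rewrite ler_wpM2r//; lra.
have [v [c [vc v1]]] := tail_le_renorm _ _ (fun n => gt0 (w n)) wK'.
have v0 n : 0 <= v n by have /andP[+ _] := vc n; apply: le_trans.
have c0 : 0 <= c.
  have /andP[a b] := vc 0%N.
  by rewrite -(pmulr_lge0 _ (gt0 (w 0%N))) (le_trans _ b).
have iter_val m (x : ell1 w) n :
    iter m (cesaro_ell1 hC) x n = iter m cesaro_op x n.
  by elim: m n => //= m IHm n; rewrite /cesaro_op; under eq_bigr do rewrite IHm.
have iterB m (x y : ell1 w) : iter m (cesaro_ell1 hC) (x - y) =
    iter m (cesaro_ell1 hC) x - iter m (cesaro_ell1 hC) y.
  by elim: m => //= m ->; rewrite linearB.
have iterP m x : iter m (cesaro_ell1 hC) (first_coord e x) = first_coord e x.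
  by elim: m => //= m ->; rewrite /first_coord linearZ/= Ce.
pose D := rnorm e / (w 0%N)%:num.
have D0 : 0 <= D by rewrite divr_ge0 ?rnorm_ge0.
(* [D] bounds the projection, [1 + D] its complement, and [c] is the cost of passing from [w] to [v]
   and back. *)
apply: (geometric_power_cvg _ (first_coord e) (3 / 4) (c * (1 + D)) D) => //.
- by lra.
- by rewrite mulr_ge0// addr_ge0.
(* As [C] fixes the range of the projection, [C^m x - P x = C^m (x - P x)], and [x - P x] lies in
   the hyperplane. *)
- move=> m x; set y := x - first_coord e x.
  suff: rnorm (iter m (cesaro_ell1 hC) y) <= c * (1 + D) * (3 / 4) ^+ m * rnorm x.
    by rewrite iterB iterP.
  have y0 : y 0%N = 0 by change (x 0%N - x 0%N * 1 = 0); rewrite mulr1 subrr.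
  apply: (@le_trans _ _ ((3 / 4) ^+ m * (c * rnorm y))).
    apply: rnorm_le => N.
    apply: (@le_trans _ _
        (\sum_(0 <= n < N) v n * normc (iter m cesaro_op y n))).
      apply: ler_sum => n _; rewrite iter_val ler_wpM2r ?normc_ge0//.
      by have /andP[] := vc n.
    rewrite (le_trans (iter_cesaro_contract _ _ _ _ v0 v1 y0))//.
    rewrite ler_wpM2l ?exprn_ge0//.
    rewrite (le_trans _ (ler_wpM2l c0 (ler_sum_rnorm y N)))// mulr_sumr.
    apply: ler_sum => n _; rewrite mulrA ler_wpM2r ?normc_ge0//.
    by have /andP[] := vc n.
  rewrite (mulrC _ (_ ^+ m)) -!mulrA ler_wpM2l ?exprn_ge0//.
  rewrite ler_wpM2l// (le_trans (rnormB _ _))// mulrDl mul1r lerD2l.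
  exact: rnorm_first_coord.
- exact: rnorm_first_coord.
Qed.
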